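(* Let $(X,e)$ be a pointed metric space with metric $d$. The canonical maps $$X\hookrightarrow\mathbb{N}[X]\hookrightarrow\mathbb{Z}[X],$$ where the first sends $x$ to $[x]$ and the second is the inclusion of formal sums with nonnegative coefficients, are isometric embeddings (for the metrics $d$, $d_{\mathbb{N}[X]}$, $d_{\mathbb{Z}[X]}$ respectively), and the second map is also a homomorphism of topological monoids.
   Context: Let $(X,d)$ be a metric space with distinguished basepoint $e\in X$. For $n\ge 1$, $\mathrm{SP}^n(X)=X^n/S_n$ is the quotient of $X^n$ by the coordinate-permutation action of the symmetric group $S_n$; the orbit of $(x_1,\dots,x_n)$ is written $[x_1,\dots,x_n]$. The map $[x_1,\dots,x_n]\mapsto[x_1,\dots,x_n,e]$ embeds $\mathrm{SP}^n(X)$ in $\mathrm{SP}^{n+1}(X)$, and the set $\mathrm{SP}(X)$ is the union $\bigcup_{n\ge1}\mathrm{SP}^n(X)$ of the increasing sequence so obtained. Thus elements of $\mathrm{SP}(X)$ are finite unordered lists $[x_1,\dots,x_m]$ of points of $X$, with $[x_1,\dots,x_m]=[x_1,\dots,x_m,e]$. Under concatenation $[x_1,\dots,x_m]+[y_1,\dots,y_n]=[x_1,\dots,x_m,y_1,\dots,y_n]$, $\mathrm{SP}(X)$ is a commutative monoid with identity $[e]$; its elements are also written as finite formal sums $\sum a_i x_i$ with nonnegative integer coefficients recording multiplicities. Matching distance: for $[x_1,\dots,x_m],[y_1,\dots,y_n]\in \mathrm{SP}(X)$ and $N\ge m+n$ let $\mathbf{x}_N=(x_1,\dots,x_m,e,\dots,e)$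 and $\mathbf{y}_N=(y_1,\dots,y_n,e,\dots,e)$ be the lists padded with copies of $e$ to length $N$, and let $\mathbf{x}_N(i)$, $\mathbf{y}_N(i)$ be their $i$-th entries. Then $$d_{\mathbb{N}[X]}([x_1,\dots,x_m],[y_1,\dots,y_n]):=\inf_{N\ge m+n}\ \min_{\sigma\in S_N}\ \sum_{i=1}^N d\bigl(\mathbf{x}_N(i),\mathbf{y}_N(\sigma(i))\bigr),$$ which is a well-defined metric on the set $\mathrm{SP}(X)$. The metric space $(\mathrm{SP}(X),d_{\mathbb{N}[X]})$, with the monoid structure above, is denoted $\mathbb{N}[X]$; it is an abelian topological monoid. $\mathbb{Z}[X]$ is the free abelian group of finite formal sums $\sum b_j y_j$ with $b_j\in\mathbb{Z}$, $y_j\in X$, in which the basepoint $e$ is identified with the zero element (so it is the group completion of $\mathbb{N}[X]$). Every $x\in\mathbb{Z}[X]$ can be written $x=x^+-x^-$ with $x^+,x^-$ finite formal sums with nonnegative coefficients, i.e. $x^{\pm}\in \mathrm{SP}(X)$. The matching distance on $\mathbb{Z}[X]$ is $d_{\mathbb{Z}[X]}(x,y):=d_{\mathbb{N}[X]}(x^{+}+y^{-},\,y^{+}+x^{-})$, which does not depend on the chosen decompositions and is a metric; $\mathbb{Z}[X]$ carries the induced topology. A homomorphism of topological monoids is a continuous monoid homomorphism. *)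

(* Defs.v *)
From HB Require Import structures.
From mathcomp Require Import all_boot all_order all_fingroup all_algebra.
From mathcomp.multinomials Require Import freeg.
From mathcomp Require Import zify generic_quotient ring_quotient.
From mathcomp Require Import boolp classical_sets reals topology normedtype.

Set Implicit Arguments.
Unset Strict Implicit.
Unset Printing Implicit Defensive.

Import Order.TTheory GRing.Theory Num.Theory.
Local Open Scope ring_scope.
Local Open Scope quotient_scope.

(* Bipartite matchings of two lists, encoded as lists of pairs; they are only
   used to prove that the matching distance below is a metric. *)
Section Couplings.
Context {R : realType} {X : metricType R}.
Implicit Types (s t u : seq X) (w : seq (X * X)) (r : R).

Definition coupling_cost w : R := \sum_(p <- w) mdist p.1 p.2.

Definition coupled s t r :=
  exists w, [/\ perm_eq (unzip1 w) s, perm_eq (unzip2 w) t &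
                coupling_cost w <= r].

Lemma coupled_perm s s' t t' r :
  perm_eq s s' -> perm_eq t t' -> coupled s t r -> coupled s' t' r.
Proof.
move=> ss tt [w [w1 w2 wr]]; exists w; split=> //.
- exact: perm_trans ss.
- exact: perm_trans tt.
Qed.

Lemma coupled_sym s t r : coupled s t r -> coupled t s r.
Proof.
move=> [w [w1 w2 wr]]; exists [seq (p.2, p.1) | p <- w]; split.
- by rewrite /unzip1 -map_comp.
- by rewrite /unzip2 -map_comp.
- rewrite /coupling_cost big_map (le_trans _ wr)// le_eqVlt.
  by apply/orP; left; apply/eqP/eq_bigr => p _; rewrite metric_sym.
Qed.

Lemma coupled_refl s r : 0 <= r -> coupled s s r.
Proof.
move=> r0; exists [seq (x, x) | x <- s]; split.
- by rewrite /unzip1 -map_comp map_id.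
- by rewrite /unzip2 -map_comp map_id.
- by rewrite /coupling_cost big_map big1// => x _; rewrite mdistxx.
Qed.

Lemma coupled_size s t r : coupled s t r -> size s = size t.
Proof. by move=> [w [/perm_size <- /perm_size <- _]]; rewrite !size_map. Qed.

Lemma coupled_cat s t s' t' r r' :
  coupled s t r -> coupled s' t' r' -> coupled (s ++ s') (t ++ t') (r + r').
Proof.
move=> [w [w1 w2 wr]] [v [v1 v2 vr]]; exists (w ++ v); split.
- by rewrite /unzip1 map_cat perm_cat.
- by rewrite /unzip2 map_cat perm_cat.
- by rewrite /coupling_cost big_cat lerD.
Qed.

Lemma coupled_le s t r r' : r <= r' -> coupled s t r -> coupled s t r'.
Proof. by move=> rr [w [? ? wr]]; exists w; split=> //; exact: le_trans rr. Qed.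

Lemma perm_map_lift (A B : eqType) (f : A -> B) (w : seq A) (s : seq B) :
  perm_eq (map f w) s -> exists2 w', perm_eq w w' & map f w' = s.
Proof.
case: w => [|a w] ws.
  by exists [::] => //; move/perm_size: ws; case: s.
rewrite perm_sym in ws.
have /(perm_iotaP (f a))[Is pI ->] := ws.
rewrite size_map in pI.
exists [seq nth a (a :: w) i | i <- Is].
  by rewrite perm_sym; apply/(perm_iotaP a); exists Is.
rewrite -map_comp; apply/eq_in_map => i /=; rewrite (perm_mem pI).
by rewrite mem_iota /= add0n => ?; rewrite -(nth_map a (f a) f (s := a :: w)).
Qed.

Lemma coupling_cost_perm w w' :
  perm_eq w w' -> coupling_cost w = coupling_cost w'.
Proof. exact: perm_big. Qed.

Lemma coupled_exact s t r : coupled s t r ->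
  exists w, [/\ unzip1 w = s, perm_eq (unzip2 w) t & coupling_cost w <= r].
Proof.
move=> [w [/perm_map_lift[w' ww' <-] w2 wr]]; exists w'; split=> //.
- by apply: perm_trans w2; rewrite perm_sym perm_map.
- by rewrite -(coupling_cost_perm ww').
Qed.

Lemma coupled_trans t s u r r' :
  coupled s t r -> coupled t u r' -> coupled s u (r + r').
Proof.
move=> /coupled_sym/coupled_exact[w [wt ws wr]].
move=> /coupled_exact[v [vt vu vr]].
have wv : size w = size v.
  by rewrite -(size_map fst) -[RHS](size_map fst) [map _ w]wt [map _ v]vt.
exists (zip (unzip2 w) (unzip2 v)); split.
- by rewrite unzip1_zip// !size_map wv.
- by rewrite unzip2_zip// !size_map wv.
- apply: le_trans (lerD wr vr); move: wt; rewrite -vt {ws vt vu wr vr}.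
  elim: w v wv => [|p w ih] [|q v]//=; rewrite /coupling_cost ?big_nil ?addr0//.
  move=> [wv] [pq wt]; rewrite !big_cons addrACA lerD//; last exact: ih.
  by rewrite (metric_sym p.1) pq /= (le_trans (metric_triangle _ q.1 _)).
Qed.

Lemma coupled_behead x s t r : coupled (x :: s) (x :: t) r -> coupled s t r.
Proof.
move=> /coupled_exact[[|[a b] w] [] //= [-> ws] wt wr].
have [bx|bx] := eqVneq b x.
  exists w; split.
  - by rewrite [unzip1 w]ws.
  - by rewrite bx perm_cons in wt.
  - by apply: le_trans wr; rewrite /coupling_cost big_cons lerDr mdist_ge0.
have : x \in unzip2 w.
  by have := perm_mem wt x; rewrite !inE eqxx eq_sym (negbTE bx).
move=> /mapP[[c d] cw /= dx]; rewrite -{d}dx in cw.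
have pw := perm_to_rem cw; set w' := rem (c, x) w in pw.
exists ((c, b) :: w'); split => /=.
- by rewrite -ws perm_sym; exact: (perm_map fst pw).
- rewrite -(perm_cons x) (perm_trans _ wt)//.
  rewrite -[x :: b :: _]/([:: x] ++ [:: b] ++ unzip2 w') perm_catCA /= perm_cons.
  by rewrite perm_sym; exact: (perm_map snd pw).
- apply: le_trans wr.
  rewrite /coupling_cost !big_cons (perm_big _ pw) big_cons /= addrA lerD2r.
  by rewrite addrC metric_triangle.
Qed.

Lemma coupled_cancel u s t r : coupled (u ++ s) (u ++ t) r -> coupled s t r.
Proof. by elim: u => //= x u ih /coupled_behead/ih. Qed.

Lemma coupled_ge0 s t r : coupled s t r -> 0 <= r.
Proof.
move=> [w [_ _ wr]]; apply: le_trans wr.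
by apply: sumr_ge0 => p _; exact: mdist_ge0.
Qed.

Lemma coupled0 s t : coupled s t 0 -> perm_eq s t.
Proof.
move=> [w [w1 w2 w0]].
have {w0} : coupling_cost w = 0.
  by apply/eqP; rewrite eq_le w0 sumr_ge0// => p _; exact: mdist_ge0.
suff e : coupling_cost w = 0 -> unzip1 w = unzip2 w.
  by move=> /e e'; rewrite perm_sym -(seq.permPr w1) perm_sym e'.
elim: w {w1 w2} => //= p w ih.
rewrite /coupling_cost big_cons => /eqP.
rewrite paddr_eq0 ?mdist_ge0 ?sumr_ge0//; last by move=> *; exact: mdist_ge0.
by move=> /andP[/eqP/mdist_positivity -> /eqP/ih ->].
Qed.

End Couplings.

Section SymmetricProduct.
Context {R : realType} {X : metricType R} (e : X).
Implicit Types (s t u : seq X) (r : R) (N : nat).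

(* A list padded with copies of the basepoint to length N (for N at least the
   length of the list). *)
Definition pad N s := s ++ nseq (N - size s)%N e.

(* Two lists of lengths m and n represent the same element of SP(X) when their
   images in SP^N(X) agree, N = max(m, n).  The empty list is also allowed; it
   represents [e]. *)
Definition SP_equiv : rel (seq X) := fun s t =>
  let N := maxn (size s) (size t) in perm_eq (pad N s) (pad N t).

Definition match_cost N s t (sigma : 'S_N) : R :=
  \sum_(i < N) mdist (nth e (pad N s) i) (nth e (pad N t) (sigma i)).

Definition match_min N s t : R :=
  \big[Num.min/match_cost s t (1%g : 'S_N)]_(sigma : 'S_N)
    match_cost s t sigma.

Definition match_dist s t : R :=
  inf [set match_min N s t | N in [set N | (size s + size t <= N)%N]]%classic.

Lemma size_pad N s : (size s <= N)%N -> size (pad N s) = N.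
Proof. by move=> sN; rewrite size_cat size_nseq subnKC. Qed.

Lemma SP_equivP s t :
  reflect (exists k l, perm_eq (s ++ nseq k e) (t ++ nseq l e)) (SP_equiv s t).
Proof.
apply: (iffP idP) => [st|[k [l]]]; first by do 2 eexists; exact: st.
move=> st; rewrite /SP_equiv /pad; set m := maxn _ _.
have sz : (size s + k = size t + l)%N.
  by have := perm_size st; rewrite !size_cat !size_nseq.
have P a b : (size s + a = size t + b)%N ->
    perm_eq (s ++ nseq a e) (t ++ nseq b e).
  move=> ab; apply/seq.permP => p; have /seq.permP/(_ p) := st.
  rewrite !count_cat !count_nseq; move: ab sz; case: (p e) => /=; lia.
apply: P; lia.
Qed.

Lemma SP_equiv_count s t :
  SP_equiv s t <-> forall x, x != e -> count_mem x s = count_mem x t.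
Proof.
split=> [/seq.permP st x xe|st].
  have := st (pred1 x); rewrite !count_cat !count_nseq /= eq_sym (negbTE xe).
  by rewrite !mul0n !addn0.
apply/SP_equivP; exists (size t), (size s).
rewrite /perm_eq; apply/allP => x _ /=; apply/eqP.
rewrite !count_cat !count_nseq /=; have [<-|ex] := eqVneq e x; last first.
  by rewrite !mul0n !addn0 st// eq_sym.
rewrite !mul1n.
have fs : perm_eq [seq x <- s | x != e] [seq x <- t | x != e].
  apply/allP => y _ /=; rewrite !count_filter.
  have [->|ye] := eqVneq y e.
    by rewrite !(@eq_count _ (predI _ _) pred0) ?count_pred0// => z /=; case: eqP.
  have E : predI (pred1 y) (fun x => x != e) =1 pred1 y.
    by move=> z /=; case: eqP => // ->; rewrite ye.
  by rewrite !(eq_count E) st.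
have := perm_size fs; rewrite !size_filter.
have E l : (count_mem e l + count (fun x => x != e) l = size l)%N.
  exact: count_predC.
by move: (E s) (E t) => <- <- ->; rewrite addnCA.
Qed.

Lemma coupled_pad N k l s t r : (size s + k)%N = N -> (size t + l)%N = N ->
  match_min N s t <= r <-> coupled (s ++ nseq k e) (t ++ nseq l e) r.
Proof.
move=> sk tl; have sN : (size s <= N)%N by lia.
have tN : (size t <= N)%N by lia.
have -> : k = (N - size s)%N by lia.
have -> : l = (N - size t)%N by lia.
rewrite -/(pad N s) -/(pad N t).
have := size_pad sN; have := size_pad tN; rewrite /match_min /match_cost.
move: (pad N s) (pad N t) => {sk tl sN tN k l}s' t' zt zs; split.
  move=> /bigmin_leP H.
  have {H}[sigma sr] : exists sigma : 'S_N,
      \sum_(i < N) mdist (nth e s' i) (nth e t' (sigma i)) <= r.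
    by case: H => [?|[sigma _ ?]]; [exists 1%g|exists sigma].
  exists [seq (nth e s' (i : 'I_N), nth e t' (sigma i)) | i : 'I_N <- enum 'I_N]; split.
  - rewrite /unzip1 -map_comp /= -[X in perm_eq _ X](mkseq_nth e) zs /mkseq.
    by rewrite -val_enum_ord -map_comp.
  - rewrite /unzip2 -map_comp /= -[X in perm_eq _ X](mkseq_nth e) zt /mkseq.
    rewrite -val_enum_ord -map_comp.
    rewrite (_ : map _ _ = map ((nth e t') \o val) (map sigma (enum 'I_N))).
      apply: perm_map; apply: uniq_perm; rewrite ?enum_uniq//.
        by rewrite (map_inj_uniq perm_inj) enum_uniq.
      move=> i; rewrite mem_enum inE; apply/mapP; exists ((sigma^-1)%g i).
        by rewrite mem_enum.
      by rewrite permKV.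
    by rewrite -[RHS]map_comp.
  - by rewrite /coupling_cost big_map big_enum.
move=> /coupled_exact[w [ws wt wr]].
have zw : size w = N by rewrite -zs -ws size_map.
have /(@tuple_permP _ _ _ (tcast zt (in_tuple t')))[sigma ts] :
  perm_eq (unzip2 w) (tcast zt (in_tuple t')) by rewrite val_tcast.
apply/bigmin_leP; right; exists sigma => //; apply: le_trans wr.
rewrite le_eqVlt; apply/orP; left; apply/eqP.
rewrite /coupling_cost (big_nth (e, e)) zw big_mkord; apply: eq_bigr => i _.
rewrite -ws (nth_map (e, e)) ?zw//; congr (mdist _ _).
rewrite -(nth_map _ e snd) ?zw// [map _ _]ts /=.
by rewrite (nth_map i) ?size_enum_ord// nth_ord_enum (tnth_nth e) val_tcast.
Qed.

Lemma le_eq_iff (a b : R) : (forall r, a <= r <-> b <= r) -> a = b.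
Proof. by move=> ab; apply/eqP; rewrite eq_le; apply/andP; split; apply/ab. Qed.

Lemma match_min_cst N M s t :
  (size s <= N)%N -> (size t <= N)%N -> (N <= M)%N ->
  match_min N s t = match_min M s t.
Proof.
move=> sN tN NM; apply: le_eq_iff => r.
rewrite (@coupled_pad _ (N - size s)%N (N - size t)%N) ?subnKC//.
rewrite (@coupled_pad M (N - size s + (M - N))%N (N - size t + (M - N))%N).
- split=> [H|].
    rewrite !nseqD !catA -[r]addr0; apply: coupled_cat => //.
    exact: coupled_refl.
  rewrite !nseqD !catA => H; apply: (@coupled_cancel _ _ (nseq (M - N)%N e)).
  by apply: coupled_perm H; rewrite perm_catC.
- lia.
- lia.
Qed.

Lemma match_distE N s t :
  (size s + size t <= N)%N -> match_dist s t = match_min N s t.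
Proof.
move=> stN; rewrite /match_dist.
rewrite (_ : [set _ | _ in _]%classic = [set match_min N s t]%classic) ?inf1//.
apply/seteqP; split=> [_ [M /= stM <-]|_ ->]; last by exists N.
have [NM|/ltnW MN] := leqP N M.
  by rewrite -(match_min_cst _ _ NM)//; lia.
by rewrite -(match_min_cst _ _ MN)//; lia.
Qed.

Lemma match_dist_leP k l s t r : (size s + k = size t + l)%N ->
  match_dist s t <= r <-> coupled (s ++ nseq k e) (t ++ nseq l e) r.
Proof.
move=> kl; set N := (size s + size t + k)%N.
rewrite (@match_distE N) ?leq_addr// -(@match_min_cst (size s + k)%N); try lia.
by rewrite (@coupled_pad _ k l)//; rewrite kl.
Qed.

Lemma match_distC s t : match_dist s t = match_dist t s.
Proof.
apply: le_eq_iff => r.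
rewrite (@match_dist_leP (size t) (size s) s t) 1?addnC//.
rewrite (@match_dist_leP (size s) (size t) t s) 1?addnC//.
by split=> /coupled_sym.
Qed.

Lemma match_dist_trans t s u :
  match_dist s u <= match_dist s t + match_dist t u.
Proof.
apply/(@match_dist_leP (size t + size u)%N (size s + size t)%N); first lia.
apply: (@coupled_trans _ _ (t ++ nseq (size s + size u)%N e)).
  by apply/match_dist_leP; [lia|exact: lexx].
by apply/match_dist_leP; [lia|exact: lexx].
Qed.

Lemma match_dist_ge0 s t : 0 <= match_dist s t.
Proof.
have := lexx (match_dist s t).
by move=> /(@match_dist_leP (size t) (size s))-/(_ (addnC _ _))/coupled_ge0.
Qed.

Lemma match_dist0 s t : match_dist s t = 0 <-> SP_equiv s t.
Proof.
split=> [st|/SP_equivP[k [l st]]].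
  apply/SP_equivP; exists (size t), (size s); apply: coupled0.
  by apply/match_dist_leP; rewrite ?st// addnC.
apply/eqP; rewrite eq_le match_dist_ge0 andbT.
apply/(@match_dist_leP k l).
  by have := perm_size st; rewrite !size_cat !size_nseq.
by apply: coupled_perm (coupled_refl _ (lexx 0)); [exact: perm_refl|exact: st].
Qed.

Lemma match_dist_cat s t s' t' :
  match_dist (s ++ s') (t ++ t') <= match_dist s t + match_dist s' t'.
Proof.
apply/(@match_dist_leP (size t + size t')%N (size s + size s')%N).
  by rewrite !size_cat; lia.
have p a b (x y : seq X) : perm_eq ((x ++ nseq a e) ++ (y ++ nseq b e))
    ((x ++ y) ++ nseq (a + b)%N e).
  by rewrite nseqD -!catA perm_cat2l perm_catCA.
apply: coupled_perm (p _ _ _ _) (p _ _ _ _) _.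
by apply: coupled_cat; apply/match_dist_leP; rewrite ?lexx// addnC.
Qed.

Lemma match_dist_cat2l u s t : match_dist (u ++ s) (u ++ t) = match_dist s t.
Proof.
apply: le_eq_iff => r.
rewrite (@match_dist_leP (size t) (size s) (u ++ s)).
  rewrite (@match_dist_leP (size t) (size s) s t) 1?addnC// -!catA.
  split=> [/coupled_cancel//|H].
  by rewrite -[r]add0r; apply: coupled_cat H; exact: coupled_refl.
by rewrite !size_cat; lia.
Qed.

Lemma SP_equiv_is_equiv : equiv_class_of SP_equiv.
Proof.
split=> [s|s t|t s u]; first by apply/SP_equiv_count.
  by apply/idP/idP => /SP_equiv_count H; apply/SP_equiv_count => x /H.
move=> /SP_equiv_count H /SP_equiv_count K.
by apply/SP_equiv_count => x xe; rewrite H// K.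
Qed.

Lemma match_dist_equiv s s' t t' :
  SP_equiv s s' -> SP_equiv t t' -> match_dist s t = match_dist s' t'.
Proof.
have le s1 s2 t1 t2 : SP_equiv s1 s2 -> SP_equiv t1 t2 ->
    match_dist s1 t1 <= match_dist s2 t2.
  move=> /match_dist0 s12 /match_dist0 t12.
  rewrite (le_trans (match_dist_trans s2 _ _))// s12 add0r.
  by rewrite (le_trans (match_dist_trans t2 _ _))// (match_distC t2) t12 addr0.
move=> ss tt; have [_ C _] := SP_equiv_is_equiv.
by apply/eqP; rewrite eq_le !le// 1?C.
Qed.

End SymmetricProduct.

Section FreeMonoid.
Context {R : realType} {X : metricType R} (e : X).

Canonical SP_equiv_canonical := EquivRelPack (SP_equiv_is_equiv e).

(* N[X]: the set SP(X) with the metric and the monoid structure below. *)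
Definition NX := {eq_quot SP_equiv e}.

HB.instance Definition _ := Choice.on NX.
HB.instance Definition _ := Quotient.on NX.
HB.instance Definition _ : EqQuotient _ (SP_equiv e) NX := EqQuotient.on NX.

(* The orbit [x_1, ..., x_m]. *)
Definition orb (s : seq X) : NX := \pi_NX s.

Lemma orbK a : orb (repr a) = a.
Proof. exact: reprK. Qed.

Lemma orb_eqP s t : orb s = orb t <-> SP_equiv e s t.
Proof. by split=> [/eqP|st]; [|apply/eqP]; rewrite piE. Qed.

Lemma SP_equiv_repr s : SP_equiv e (repr (orb s)) s.
Proof. by apply/orb_eqP; rewrite orbK. Qed.

Definition NX_add (a b : NX) : NX := orb (repr a ++ repr b).

Lemma NX_addE s t : NX_add (orb s) (orb t) = orb (s ++ t).
Proof.
apply/orb_eqP/SP_equiv_count => x xe; rewrite !count_cat.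
by have /SP_equiv_count -> := SP_equiv_repr s => //;
   have /SP_equiv_count -> := SP_equiv_repr t.
Qed.

Lemma NX_addA : associative NX_add.
Proof.
by move=> a b c; rewrite -[a]orbK -[b]orbK -[c]orbK !NX_addE catA.
Qed.

Lemma NX_addC : commutative NX_add.
Proof.
move=> a b; rewrite -[a]orbK -[b]orbK !NX_addE.
by apply/orb_eqP/SP_equiv_count => x _; rewrite !count_cat addnC.
Qed.

Lemma NX_add0 : left_id (orb [:: e]) NX_add.
Proof.
move=> a; rewrite -[a]orbK NX_addE.
by apply/orb_eqP/SP_equiv_count => x xe /=; rewrite eq_sym (negbTE xe).
Qed.

HB.instance Definition _ := GRing.isNmodule.Build NX NX_addA NX_addC NX_add0.

Lemma orbD s t : orb (s ++ t) = orb s + orb t.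
Proof. by rewrite -NX_addE. Qed.

Lemma orb_nil : orb [::] = 0.
Proof.
by apply/orb_eqP/SP_equiv_count => x xe /=; rewrite eq_sym (negbTE xe).
Qed.

Definition NX_dist (a b : NX) : R := match_dist e (repr a) (repr b).

Lemma NX_distE s t : NX_dist (orb s) (orb t) = match_dist e s t.
Proof. by apply: match_dist_equiv; exact: SP_equiv_repr. Qed.

Lemma NX_distxx a : NX_dist a a = 0.
Proof. by apply/match_dist0; rewrite equiv_refl. Qed.

Lemma NX_dist_eq0 a b : NX_dist a b = 0 -> a = b.
Proof. by move=> /match_dist0 /orb_eqP; rewrite !orbK. Qed.

Lemma NX_distC a b : NX_dist a b = NX_dist b a.
Proof. exact: match_distC. Qed.

Lemma NX_dist_trans b a c : NX_dist a c <= NX_dist a b + NX_dist b c.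
Proof. exact: match_dist_trans. Qed.

HB.instance Definition _ :=
  isMetric.Build R NX NX_distxx NX_dist_eq0 NX_distC NX_dist_trans.

Lemma mdistN (a b : NX) : mdist a b = NX_dist a b.
Proof. by []. Qed.

Lemma NX_distD (a b c d : NX) :
  NX_dist (a + c) (b + d) <= NX_dist a b + NX_dist c d.
Proof.
rewrite -[a]orbK -[b]orbK -[c]orbK -[d]orbK -!orbD !NX_distE.
exact: match_dist_cat.
Qed.

Lemma NX_dist_add2l (c a b : NX) : NX_dist (c + a) (c + b) = NX_dist a b.
Proof.
rewrite -[a]orbK -[b]orbK -[c]orbK -!orbD !NX_distE.
exact: match_dist_cat2l.
Qed.

Lemma NX_add_continuous : continuous (fun x : NX * NX => x.1 + x.2).
Proof.
move=> [a b]; apply/metricType_numDomainType.cvgrPdist_lt => eps eps0 /=.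
have e2 : 0 < eps / 2 by rewrite divr_gt0.
exists (ball a (eps / 2), ball b (eps / 2)) => /=.
  by split; exact: nbhsx_ballx.
move=> [c d] [/=]; rewrite !ballEmdist /= => ac bd.
by rewrite (le_lt_trans (NX_distD _ _ _ _))// [eps]splitr ltrD.
Qed.

HB.instance Definition _ :=
  PreTopologicalNmodule_isTopologicalNmodule.Build NX NX_add_continuous.

End FreeMonoid.

Section FreeGroup.
Context {R : realType} {X : metricType R} (e : X).

Definition basepoint_span (D : {freeg X / int}) : bool :=
  D == << coeff e D *g e >>.

Lemma basepoint_spanP D :
  reflect (forall x, x != e -> coeff x D = 0) (D \in basepoint_span).
Proof.
rewrite unfold_in; apply: (iffP eqP) => [-> x xe|De].
  by rewrite coeffU eq_sym (negbTE xe) mulr0.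
apply/eqP/freeg_eqP => x; rewrite coeffU; have [<-|ex] := eqVneq e x.
  by rewrite mulr1.
by rewrite De 1?eq_sym// mulr0.
Qed.

Lemma basepoint_span_zmod_closed : zmod_closed basepoint_span.
Proof.
split=> [|D E /basepoint_spanP D0 /basepoint_spanP E0]; apply/basepoint_spanP.
  by move=> x _; rewrite coeff0.
by move=> x xe; rewrite coeffB D0// E0// subr0.
Qed.

HB.instance Definition _ :=
  GRing.isZmodClosed.Build {freeg X / int} basepoint_span
    basepoint_span_zmod_closed.

(* Z[X]: the free abelian group on X modulo the multiples of e. *)
Definition ZX :=
  Quotient.quot (GRing.ZmodClosed.clone {freeg X / int} basepoint_span _).

HB.instance Definition _ := GRing.Zmodule.on ZX.
HB.instance Definition _ := Quotient.on ZX.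

Definition zcls (D : {freeg X / int}) : ZX := \pi_ZX D.

Lemma zcls_eqP D E :
  zcls D = zcls E <-> forall x, x != e -> coeff x D = coeff x E.
Proof.
have -> : zcls D = zcls E <-> D - E \in basepoint_span.
  by split=> [/eqP|DE]; [|apply/eqP]; rewrite /zcls -Quotient.idealrBE.
split=> [/basepoint_spanP DE x /DE/eqP|DE].
  by rewrite coeffB subr_eq0 => /eqP.
by apply/basepoint_spanP => x /DE DEx; rewrite coeffB DEx subrr.
Qed.

Lemma zclsD D E : zcls (D + E) = zcls D + zcls E.
Proof. exact: raddfD. Qed.

Lemma zclsN D : zcls (- D) = - zcls D.
Proof. exact: raddfN. Qed.

Lemma zcls_sum (I : Type) (r : seq I) (F : I -> {freeg X / int}) :
  zcls (\sum_(i <- r) F i) = \sum_(i <- r) zcls (F i).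
Proof. exact: raddf_sum. Qed.

(* The list in which each x is repeated max(coeff x D, 0) times. *)
Definition pos_part (D : {freeg X / int}) : seq X :=
  flatten [seq nseq `|Num.max (coeff x D) 0|%N x | x <- dom D].

Lemma count_pos_part D x :
  (count_mem x (pos_part D))%:Z = Num.max (coeff x D) 0.
Proof.
have m0 y : 0 <= Num.max (coeff y D) 0 by rewrite le_max lexx orbT.
rewrite /pos_part count_flatten -map_comp sumnE big_map.
under eq_bigr do rewrite /= count_nseq /=.
have [xD|xD] := boolP (x \in dom D).
  rewrite (bigD1_seq x) ?uniq_dom//= eqxx mul1n big1 ?addn0 ?gez0_abs// => y.
  by move=> yx; rewrite (negbTE yx).
rewrite (coeff_outdom xD) maxxx big1_seq// => y /= yD.
by case: eqP => [yx|//]; rewrite yx (negbTE xD) in yD.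
Qed.

(* A decomposition u = u^+ - u^- (see ZX_posneg). *)
Definition ZX_pos (u : ZX) : NX e := orb e (pos_part (repr u)).
Definition ZX_neg (u : ZX) : NX e := orb e (pos_part (- repr u)).

Definition ZX_dist (u v : ZX) : R :=
  NX_dist (ZX_pos u + ZX_neg v) (ZX_pos v + ZX_neg u).

Definition XtoN (x : X) : NX e := orb e [:: x].

Definition NtoZ (a : NX e) : ZX := \sum_(x <- repr a) zcls << x >>.

Lemma coeff_sum_seq (s : seq X) x :
  coeff x (\sum_(y <- s) << y >> : {freeg X / int}) = (count_mem x s)%:Z.
Proof.
elim: s => [|y s ih]; first by rewrite big_nil coeff0.
by rewrite big_cons coeffD ih coeffU mul1r /= PoszD; case: eqP.
Qed.

Lemma NtoZ_orb s : NtoZ (orb e s) = \sum_(x <- s) zcls << x >>.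
Proof.
rewrite /NtoZ -!zcls_sum; apply/zcls_eqP => x xe; rewrite !coeff_sum_seq.
by have /SP_equiv_count -> := SP_equiv_repr e s.
Qed.

Lemma NtoZ_addE a b : NtoZ (a + b) = NtoZ a + NtoZ b.
Proof.
by rewrite -[a]orbK -[b]orbK -orbD !NtoZ_orb big_cat.
Qed.

Lemma NtoZ_inj : injective NtoZ.
Proof.
move=> a b; rewrite -[a]orbK -[b]orbK !NtoZ_orb -!zcls_sum => /zcls_eqP ab.
apply/orb_eqP/SP_equiv_count => x /ab; rewrite !coeff_sum_seq.
by move=> [].
Qed.

Lemma ZX_posneg u : u = NtoZ (ZX_pos u) - NtoZ (ZX_neg u).
Proof.
rewrite /ZX_pos /ZX_neg !NtoZ_orb -!zcls_sum -zclsN -zclsD -[u in LHS]reprK.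
apply/zcls_eqP => x _; rewrite coeffB !coeff_sum_seq !count_pos_part coeffN.
lia.
Qed.

(* The value of the distance does not depend on the decompositions chosen. *)
Lemma ZX_distE a b c d :
  ZX_dist (NtoZ a - NtoZ b) (NtoZ c - NtoZ d) = NX_dist (a + d) (c + b).
Proof.
set u := NtoZ a - NtoZ b; set v := NtoZ c - NtoZ d.
have eu : ZX_pos u + b = a + ZX_neg u.
  apply: NtoZ_inj; rewrite !NtoZ_addE; have := ZX_posneg u; rewrite {1}/u.
  by move/eqP; rewrite subr_eq addrAC eq_sym subr_eq => /eqP.
have ev : ZX_pos v + d = c + ZX_neg v.
  apply: NtoZ_inj; rewrite !NtoZ_addE; have := ZX_posneg v; rewrite {1}/v.
  by move/eqP; rewrite subr_eq addrAC eq_sym subr_eq => /eqP.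
rewrite /ZX_dist -(NX_dist_add2l (b + d)).
rewrite -[RHS](NX_dist_add2l (ZX_neg u + ZX_neg v)); congr NX_dist.
  rewrite [LHS](AC (2*2) ((3*1)*(4*2))) /= eu.
  by rewrite [LHS](AC (2*2) ((2*3)*(1*4))).
rewrite [LHS](AC (2*2) ((3*2)*(4*1))) /= ev.
by rewrite [LHS](AC (2*2) ((3*2)*(1*4))).
Qed.

Lemma ZX_distxx u : ZX_dist u u = 0.
Proof. exact: NX_distxx. Qed.

Lemma ZX_dist_eq0 u v : ZX_dist u v = 0 -> u = v.
Proof.
move=> /NX_dist_eq0/(congr1 NtoZ); rewrite !NtoZ_addE => /eqP uv.
rewrite (ZX_posneg u) (ZX_posneg v); apply/eqP.
by rewrite subr_eq addrAC eq_sym subr_eq eq_sym.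
Qed.

Lemma ZX_distC u v : ZX_dist u v = ZX_dist v u.
Proof. exact: NX_distC. Qed.

Lemma ZX_dist_trans v u w : ZX_dist u w <= ZX_dist u v + ZX_dist v w.
Proof.
rewrite /ZX_dist -[leLHS](NX_dist_add2l (ZX_pos v + ZX_neg v)).
have -> : ZX_pos v + ZX_neg v + (ZX_pos u + ZX_neg w) =
    (ZX_pos u + ZX_neg v) + (ZX_pos v + ZX_neg w).
  by rewrite [LHS](AC (2*2) ((3*2)*(1*4))).
have -> : ZX_pos v + ZX_neg v + (ZX_pos w + ZX_neg u) =
    (ZX_pos v + ZX_neg u) + (ZX_pos w + ZX_neg v).
  by rewrite [LHS](AC (2*2) ((1*4)*(3*2))).
exact: NX_distD.
Qed.

HB.instance Definition _ :=
  isMetric.Build R ZX ZX_distxx ZX_dist_eq0 ZX_distC ZX_dist_trans.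

Lemma ZX_distB (u v u' v' : ZX) :
  ZX_dist (u - v) (u' - v') <= ZX_dist u u' + ZX_dist v v'.
Proof.
have B w w' : w - w' =
    NtoZ (ZX_pos w + ZX_neg w') - NtoZ (ZX_neg w + ZX_pos w').
  rewrite {1}(ZX_posneg w) {1}(ZX_posneg w') !NtoZ_addE !opprD opprK.
  by rewrite [LHS](AC (2*2) ((1*4)*(2*3))).
rewrite (B u v) (B u' v') ZX_distE [ZX_dist v v']NX_distC.
have -> : ZX_pos u + ZX_neg v + (ZX_neg u' + ZX_pos v') =
    (ZX_pos u + ZX_neg u') + (ZX_pos v' + ZX_neg v).
  by rewrite [LHS](AC (2*2) ((1*3)*(4*2))).
have -> : ZX_pos u' + ZX_neg v' + (ZX_neg u + ZX_pos v) =
    (ZX_pos u' + ZX_neg u) + (ZX_pos v + ZX_neg v').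
  by rewrite [LHS](AC (2*2) ((1*3)*(4*2))).
exact: NX_distD.
Qed.

Lemma ZX_sub_continuous : continuous (fun x : ZX * ZX => x.1 - x.2).
Proof.
move=> [a b]; apply/metricType_numDomainType.cvgrPdist_lt => eps eps0 /=.
have e2 : 0 < eps / 2 by rewrite divr_gt0.
exists (ball a (eps / 2), ball b (eps / 2)) => /=.
  by split; exact: nbhsx_ballx.
move=> [c d] [/=]; rewrite !ballEmdist /= => ac bd.
by rewrite (le_lt_trans (ZX_distB _ _ _ _))// [eps]splitr ltrD.
Qed.

Lemma mdistZ (u v : ZX) : mdist u v = ZX_dist u v.
Proof. by []. Qed.

HB.instance Definition _ :=
  PreTopologicalNmodule_isTopologicalZmodule.Build ZX ZX_sub_continuous.

End FreeGroup.

Definition isometric_embedding (R : realType) (M N : metricType R)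
    (f : M -> N) : Prop :=
  forall x y, mdist (f x) (f y) = mdist x y.

Definition topological_monoid_hom (M N : TopologicalNmodule.type)
    (f : M -> N) : Prop :=
  nmod_morphism f /\ continuous f.

(* Main.v *)
Require Import Defs.
From mathcomp Require Import all_boot all_order all_algebra.
From mathcomp Require Import boolp classical_sets reals topology normedtype.

(** Both isometries come down to cancellation in a matching.

    For [x] and [y], pad the two lists with copies of the basepoint.  A matching
    of the padded lists may route x and y through basepoints, at cost
    d(x, e) + d(e, y), which the triangle inequality bounds below by d(x, y).
    So the same number of basepoints can be removed from both sides
    without changing the distance ([match_dist_leP] at padding 0), and the only
    matching left is the one that pairs x with y.

    For formal sums, an element a of N[X] is the difference of a and 0 in Z[X].
    As the distance in Z[X] may be computed from any decomposition
    ([ZX_distE]), this one returns the distance in N[X].  Continuity of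
    the inclusion is then a consequence of its being isometric. *)

Import Order.TTheory GRing.Theory Num.Theory.
Local Open Scope ring_scope.

Lemma coupled1 (R : realType) (X : metricType R) (x y : X) (r : R) :
  coupled [:: x] [:: y] r <-> mdist x y <= r.
Proof.
split=> [/coupled_exact[w [wx wy wr]]|xyr].
  have {}wy := perm_small_eq (isT : size [:: y] <= 1)%N wy.
  case: w wx wy wr => [|[a b] [|? ?]] //= [->] [->].
  by rewrite /coupling_cost big_seq1.
exists [:: (x, y)]; split=> //.
by rewrite /coupling_cost big_seq1.
Qed.

(** A matching through the basepoint never beats the direct one: lists of equal
    length can be compared without any padding. *)
Lemma match_dist1 (R : realType) (X : metricType R) (e x y : X) :
  match_dist e [:: x] [:: y] = mdist x y.
Proof.
apply: le_eq_iff => r.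
by rewrite (@match_dist_leP _ _ e 0 0) // !cats0 coupled1.
Qed.

Lemma NtoZ0 (R : realType) (X : metricType R) (e : X) : @NtoZ R X e 0 = 0.
Proof. by rewrite -orb_nil NtoZ_orb big_nil. Qed.

(** Taking 0 as the negative part of both formal sums is a legitimate choice of
    decomposition, and the distance in Z[X] does not see the choice. *)
Lemma NtoZ_isometric (R : realType) (X : metricType R) (e : X) :
  isometric_embedding (@NtoZ R X e).
Proof.
move=> a b; rewrite mdistZ mdistN.
by rewrite -[NtoZ a]subr0 -[NtoZ b]subr0 -NtoZ0 ZX_distE !addr0.
Qed.

Lemma isometric_embedding_continuous (R : realType) (M N : metricType R)
    (f : M -> N) : isometric_embedding f -> continuous f.
Proof.
move=> f_iso a; apply/metricType_numDomainType.cvgrPdist_lt => eps eps0 /=.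
have := nbhsx_ballx a eps eps0; apply: filterS => b.
by rewrite ballEmdist /= f_iso.
Qed.

Theorem theorem5p4 (R : realType) (X : metricType R) (e : X) :
  isometric_embedding (XtoN e) /\
  isometric_embedding (@NtoZ R X e) /\
  topological_monoid_hom (@NtoZ R X e).
Proof.
split; first by move=> x y; rewrite mdistN NX_distE match_dist1.
split; first exact: NtoZ_isometric.
split; first by split; [exact: NtoZ0|exact: NtoZ_addE].
exact: isometric_embedding_continuous (@NtoZ_isometric R X e).
Qed.
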